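(* Up to constants, there are exactly three normalized rational specializations of the HOMFLY polynomial, two nondegenerate and one degenerate. That is, if $(F,G)$ is a normalized rational specialization, then the pair of roots $\{r_1,r_2\}$ of its characteristic equation is, up to multiplying each of the two roots by a nonzero complex constant, one of the following, and each of these three pairs is the pair of roots of a normalized rational specialization: 1) (Alexander-Conway) $r_1=-s,\ r_2=s^{-1}$; 2) (Jones) $r_1=-s,\ r_2=s^{3}$; 3) (degenerate) $r_1=r_2=s$.
   Context: The HOMFLY polynomial is the oriented link invariant $P$ with values in $\mathbb{C}[l^{\pm1},m^{\pm1}]$ determined by $P(\bigcirc)=1$ (unknot) and $lP(L_+)+l^{-1}P(L_-)+mP(L_0)=0$ (skein relation for positive crossing, negative crossing, oriented smoothing). In particular its value on the two-component unlink is $P(\bigcirc\bigcirc)=-\frac{l+l^{-1}}{m}$. The characteristic equation of the HOMFLY recurrence is $r^2+ml\,r+l^2=0$. A rational specialization of $P(l,m)$ is a specialization $l=F(s)$, $m=G(s)$, where $F,G\in\mathbb{C}(s)$ are nonzero rational functions, such that: (a) $P(\bigcirc\bigcirc)(F(s),G(s))$ is a Laurent polynomial in $s$; (b) the roots of the characteristic equation (with $l=F(s)$, $m=G(s)$) are $r_1=\lambda s^{n}$, $r_2=\mu s^{k}$, where $n,k$ are coprime integers and $\lambda,\mu$ are nonzero complex numbers. It is called normalized if $n=1$, and nondegenerate if $n\ne k$ (degenerate if $n=k$). The Alexander-Conway specialization is $l=\mathrm{i}$, $m=\mathrm{i}(s^{-1}-s)$, the Jones specialization is $l=\mathrm{i}s^2$,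 $m=\mathrm{i}(s-s^{-1})$, where $\mathrm{i}^2=-1$. *)

(* Defs.v *)
From HB Require Import structures.
From mathcomp Require Import all_boot all_order all_algebra.
From mathcomp Require Import fraction complex reals.

Set Implicit Arguments.
Unset Strict Implicit.
Unset Printing Implicit Defensive.

Import Order.TTheory GRing.Theory Num.Theory.
Local Open Scope ring_scope.

(* The value P(OO) of the HOMFLY polynomial on the two-component unlink.      *)
(* l, m range over a field so that they can be the formal variables as well   *)
(* as their images under a specialization.                                    *)
Definition homfly_unlink2 (K : fieldType) (l m : K) : K := - (l + l^-1) / m.

(* The skein relation determines that value: apply it to the two one-crossing *)
(* diagrams of the unknot, on which P = 1; smoothing the crossing gives OO.   *)
Lemma homfly_unlink2P (K : fieldType) (l m x : K) : m != 0 ->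
  l * 1 + l^-1 * 1 + m * x = 0 <-> x = homfly_unlink2 l m.
Proof.
move=> m0; rewrite !mulr1 /homfly_unlink2; split=> [/eqP|->].
  by rewrite addrC addr_eq0 => /eqP <-; rewrite mulrAC mulfV ?mul1r.
by rewrite mulrC mulfVK // subrr.
Qed.

(* r^2 + m l r + l^2 *)
Definition homfly_char (K : fieldType) (l m : K) : {poly K} :=
  'X^2 + (m * l) *: 'X + (l ^+ 2)%:P.

(* r1, r2 are the two roots, listed with multiplicity. *)
Definition homfly_char_roots (K : fieldType) (l m r1 r2 : K) : Prop :=
  homfly_char l m = ('X - r1%:P) * ('X - r2%:P).

Section RationalSpecialization.
Variable R : realType.

(* C(s), where C = R[i] *)
Definition ratfun : fieldType := {fraction {poly R[i]}}.

Definition svar : ratfun := tofrac 'X.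
Definition rconst (c : R[i]) : ratfun := tofrac c%:P.

Definition is_laurent (f : ratfun) : Prop :=
  exists (p : {poly R[i]}) (N : nat), f = tofrac p / svar ^+ N.

Definition rational_specialization (F G : ratfun) (n k : int) : Prop :=
  [/\ F != 0, G != 0, is_laurent (homfly_unlink2 F G), coprimez n k
    & exists lam mu : R[i],
        [/\ lam != 0, mu != 0
          & homfly_char_roots F G (rconst lam * svar ^ n)
                                  (rconst mu * svar ^ k)]].

Definition normalized_specialization (F G : ratfun) : Prop :=
  exists k : int, rational_specialization F G 1 k.

Definition nondegenerate_specialization (F G : ratfun) : Prop :=
  exists n k : int, n <> k /\ rational_specialization F G n k.

Definition degenerate_specialization (F G : ratfun) : Prop :=
  exists n : int, rational_specialization F G n n.

(* Equality of the unordered pairs {r1, r2} and {t1, t2} after multiplying    *)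
(* each element by its own nonzero complex constant.                          *)
Definition same_pair_upto_const (r1 r2 t1 t2 : ratfun) : Prop :=
  exists a b : R[i],
    [/\ a != 0, b != 0
      & (r1 = rconst a * t1 /\ r2 = rconst b * t2) \/
        (r1 = rconst a * t2 /\ r2 = rconst b * t1)].

Definition alexander_conway_l : ratfun := rconst 'i%C.
Definition alexander_conway_m : ratfun := rconst 'i%C * (svar^-1 - svar).

Definition jones_l : ratfun := rconst 'i%C * svar ^+ 2.
Definition jones_m : ratfun := rconst 'i%C * (svar - svar^-1).

End RationalSpecialization.

Arguments svar {R}.
Arguments alexander_conway_l {R}.
Arguments alexander_conway_m {R}.
Arguments jones_l {R}.
Arguments jones_m {R}.

(* Main.v *)
(* The roots give [F ^ 2 = r1 r2 = lam mu s ^ (k + 1)] and                    *)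
(* [P(OO) = (r1 r2 + 1) / (r1 + r2)].  The first equation forces [k] to be    *)
(* odd.  If [k <> 1], put [d = |k - 1|]: up to powers of [s], the denominator *)
(* is [s ^ d + c] with [c != 0], and modulo it the numerator reduces to a     *)
(* nonzero polynomial of degree at most 2; hence [d <= 2], so [k] is -1 or 3. *)
Require Import Defs.
From HB Require Import structures.
From mathcomp Require Import all_boot all_order all_algebra.
From mathcomp Require Import fraction complex reals generic_quotient.
From mathcomp Require Import ring zify.

Set Implicit Arguments.
Unset Strict Implicit.
Unset Printing Implicit Defensive.

Import Order.TTheory GRing.Theory Num.Theory.
Local Open Scope ring_scope.

(** Up to constants, a pair of monomial roots is its pair of exponents, so the task is to find the
    possible [k] in the roots [lam * s] and [mu * s ^ k]. By Vieta, [P(OO)] depends on the roots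
    alone ([homfly_unlink2_roots]). For [k <> 1] their sum is a monomial times a binomial coprime to
    [s]. Since [P(OO)] is Laurent, this binomial must divide the numerator, whose nonzero remainder
    is too small unless [|k - 1| <= 2] ([laurent_exponent]). The product of the roots is the square
    of [F], and no odd power of [s] times a nonzero constant is a square in C(s)
    ([odd_monomial_not_sqr]), so [k] is odd. This leaves -1, 1 and 3. Explicit [F] and [G] realize
    each value, and comparing exponents separates the three pairs ([same_pair_monomialP]). *)

(** * Vieta relations for the characteristic equation *)

Lemma homfly_char_rootsP (K : fieldType) (l m r1 r2 : K) :
  homfly_char_roots l m r1 r2 <-> m * l = - (r1 + r2) /\ l ^+ 2 = r1 * r2.
Proof.
have prodE : ('X - r1%:P) * ('X - r2%:P)
    = 'X^2 + (- (r1 + r2)) *: 'X + (r1 * r2)%:P.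
  by rewrite -mul_polyC polyCN polyCM polyCD; ring.
rewrite /homfly_char_roots prodE /homfly_char; split=> [eq_p|[-> ->]].
  have coefE i := congr1 (fun p : {poly K} => p`_i) eq_p.
  move: (coefE 0) (coefE 1).
  rewrite !(coefD, coefZ, coefXn, coefX, coefC) /=.
  by rewrite !(mulr0, mulr1, addr0, add0r) => -> ->.
by [].
Qed.

(** Expanding [-(l + l^-1) / m] by [l] gives [(l ^+ 2 + 1) / - (m * l)], in which Vieta replaces
    both [l ^+ 2] and [m * l]. *)
Lemma homfly_unlink2_roots (K : fieldType) (l m r1 r2 : K) :
    l != 0 -> m != 0 -> homfly_char_roots l m r1 r2 ->
  homfly_unlink2 l m * (r1 + r2) = r1 * r2 + 1.
Proof.
move=> l0 m0 /homfly_char_rootsP[ml ll].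
have -> : r1 + r2 = - (m * l) by rewrite ml opprK.
by rewrite -ll /homfly_unlink2; field; rewrite l0 m0.
Qed.

(** Passes from an arbitrary listing of the roots to the monomial one provided by a
    specialization. *)
Lemma homfly_char_roots_uniq (K : fieldType) (l m r1 r2 t1 t2 : K) :
    homfly_char_roots l m r1 r2 -> homfly_char_roots l m t1 t2 ->
  (r1 = t1 /\ r2 = t2) \/ (r1 = t2 /\ r2 = t1).
Proof.
move=> /homfly_char_rootsP[mlE llE] /homfly_char_rootsP[].
rewrite mlE llE => /oppr_inj sumE prodE.
have /eqP : (r1 - t1) * (r1 - t2) = 0.
  have -> : (r1 - t1) * (r1 - t2) = r1 * r1 - r1 * (t1 + t2) + t1 * t2 by ring.
  by rewrite -sumE -prodE; ring.
rewrite mulf_eq0 !subr_eq0 => /orP[]/eqP r1E; [left|right]; split=> //.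
  by apply: (addrI r1); rewrite sumE r1E.
by apply: (addrI r1); rewrite sumE r1E addrC.
Qed.

(** * Divisibility bounds on the gap between the exponents *)

(* Since [c != 0], ['X^d + c] is coprime to ['X^N]. *)
Lemma dvdp_XnDC_le2 (K : fieldType) (d N : nat) (a b c : K) (q : {poly K}) :
    (0 < d)%N -> c != 0 -> b != 0 ->
    'X^d + c%:P %| 'X^N * (a *: 'X^2 + b%:P + q * ('X^d + c%:P)) ->
  (d <= 2)%N.
Proof.
move=> d0 c0 b0.
rewrite Gauss_dvdpr; last first.
  apply: coprimep_expr.
  by rewrite coprimepX /root !hornerE expr0n gtn_eqF // add0r.
rewrite dvdp_addl ?dvdp_mull // => /dvdp_leq.
have -> : a *: 'X^2 + b%:P != 0.
  apply/negP=> /eqP/(congr1 (fun p : {poly K} => p`_0)).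
  by rewrite coefD coefZ coefXn coefC /= mulr0 add0r coef0 => /eqP; apply/negP.
move=> /(_ isT); rewrite size_XnaddC // => /leq_trans/(_ (size_polyD _ _)).
have sz2 : (size (a *: 'X^2) <= 3)%N
  by rewrite (leq_trans (size_scale_leq _ _)) ?size_polyXn.
have sz0 : (size b%:P <= 1)%N by rewrite size_polyC leq_b1.
rewrite leq_max => /orP[] lt_d; rewrite -ltnS; apply: (leq_trans lt_d) => //.
exact: (leq_trans sz0).
Qed.

(** The case [k = 1 + d], with [P(OO) = p / s ^+ N] and denominators cleared. The sum of the roots
    is [b X (X^d + c)] with [c = a / b]; modulo [X^d + c], the numerator [a b X^2 X^d + 1] becomes
    [1 - a^2 X^2]. *)
Lemma laurent_gap_above_le2 (K : fieldType) (d N : nat) (a b : K)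
    (p : {poly K}) :
    (0 < d)%N -> a != 0 -> b != 0 ->
    p * (a%:P * 'X + b%:P * ('X * 'X^d))
      = 'X^N * (a%:P * 'X * (b%:P * ('X * 'X^d)) + 1) ->
  (d <= 2)%N.
Proof.
move=> d0 a0 b0 pE; pose c := a / b.
have aE : a%:P = b%:P * c%:P by rewrite -polyCM mulrC divfK.
apply: (@dvdp_XnDC_le2 K d N (- a ^+ 2) 1 c (a%:P * b%:P * 'X^2)) => //.
- by rewrite mulf_neq0 ?invr_eq0.
- exact: oner_neq0.
apply/dvdpP; exists (p * (b%:P * 'X)).
transitivity ('X^N * (a%:P * 'X * (b%:P * ('X * 'X^d)) + 1)).
  by rewrite -mul_polyC polyCN polyCM polyC1 !aE; ring.
by rewrite -pE aE; ring.
Qed.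

(** The case [k = 1 - d], where clearing denominators takes a further factor [X^d]. The sum becomes
    [a X (X^d + c)] with [c = b / a], and the numerator [a b X^2 + X^d] reduces to [a b X^2 - c]. *)
Lemma laurent_gap_below_le2 (K : fieldType) (d N : nat) (a b : K)
    (p : {poly K}) :
    (0 < d)%N -> a != 0 -> b != 0 ->
    p * (a%:P * 'X * 'X^d + b%:P * 'X)
      = 'X^N * (a%:P * 'X * (b%:P * 'X) + 'X^d) ->
  (d <= 2)%N.
Proof.
move=> d0 a0 b0 pE; pose c := b / a.
have bE : b%:P = a%:P * c%:P by rewrite -polyCM mulrC divfK.
have c0 : c != 0 by rewrite mulf_neq0 ?invr_eq0.
apply: (@dvdp_XnDC_le2 K d N (a * b) (- c) c 1) => //.
  by rewrite oppr_eq0.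
apply/dvdpP; exists (p * (a%:P * 'X)).
transitivity ('X^N * (a%:P * 'X * (b%:P * 'X) + 'X^d)).
  by rewrite -mul_polyC polyCN polyCM; ring.
by rewrite -pE bE; ring.
Qed.

(** * The three examples over an arbitrary field *)

Lemma homfly_char_roots_alexander_conway (K : fieldType) (i s : K) :
    i ^+ 2 = -1 -> s != 0 ->
  homfly_char_roots i (i * (s^-1 - s)) (- s) s^-1.
Proof.
move=> i2 s0; apply/homfly_char_rootsP; split.
  by rewrite mulrAC -expr2 i2; ring.
by rewrite i2 mulNr mulfV.
Qed.

Lemma homfly_char_roots_jones (K : fieldType) (i s : K) :
    i ^+ 2 = -1 -> s != 0 ->
  homfly_char_roots (i * s ^+ 2) (i * (s - s^-1)) (- s) (s ^+ 3).
Proof.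
move=> i2 s0; apply/homfly_char_rootsP; split.
  by rewrite mulrACA -expr2 i2; field.
by rewrite exprMn i2; ring.
Qed.

(** With [m = -2] the characteristic polynomial is the perfect square [(r - l)^2]. *)
Lemma homfly_char_roots_double (K : fieldType) (s : K) :
  homfly_char_roots s (- 2) s s.
Proof. by apply/homfly_char_rootsP; split; ring. Qed.

Lemma homfly_unlink2_alexander_conway (K : fieldType) (i m : K) :
  i ^+ 2 = -1 -> homfly_unlink2 i m = 0.
Proof.
move=> i2; have i0 : i != 0 by rewrite -sqrf_eq0 i2 oppr_eq0 oner_eq0.
rewrite /homfly_unlink2 -[i + _](mulfK i0) mulrDl mulVf // -expr2 i2 addNr.
by rewrite !mul0r oppr0 mul0r.
Qed.

Lemma homfly_unlink2_jones (K : fieldType) (i s : K) :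
    i ^+ 2 = -1 -> s != 0 -> s - s^-1 != 0 ->
  homfly_unlink2 (i * s ^+ 2) (i * (s - s^-1)) = - (s ^+ 2 + 1) / s.
Proof.
move=> i2 s0 sV0; have i0 : i != 0 by rewrite -sqrf_eq0 i2 oppr_eq0 oner_eq0.
apply: (mulIf (mulf_neq0 i0 sV0)); rewrite /homfly_unlink2 divfK ?mulf_neq0 //.
have iV : i^-1 = - i.
  by apply: (mulfI i0); rewrite mulfV // mulrN -expr2 i2 opprK.
by rewrite invfM iV; field.
Qed.

Lemma homfly_unlink2_double (K : fieldType) (s : K) :
  2 != 0 :> K -> s != 0 -> homfly_unlink2 s (- 2) = 2^-1 * (s ^+ 2 + 1) / s.
Proof.
by move=> two0 s0; rewrite /homfly_unlink2; field; rewrite s0 oppr_eq0 two0.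
Qed.

(** * Monomials and squares in C(s) *)

Lemma fracP (D : idomainType) (f : {fraction D}) :
  exists p q : D, q != 0 /\ f * tofrac q = tofrac p.
Proof.
elim/quotW: f => x; exists (frac x).1, (frac x).2; split.
  exact: denom_ratioP.
unlock tofrac; rewrite -[LHS]FracField.pi_mul; apply/eqmodP.
rewrite /= FracField.equivfE /FracField.mulf.
by rewrite !numden_Ratio ?mulf_neq0 ?oner_eq0 ?denom_ratioP // !mulr1 mulrC.
Qed.

Section RationalFunctions.
Variable R : realType.
Local Notation s := (@svar R).
Local Notation C := R[i].

Lemma svar_neq0 : s != 0.
Proof. by rewrite /svar tofrac_eq0 polyX_eq0. Qed.

Lemma rconst_eq0 (a : C) : (rconst a == 0) = (a == 0).
Proof. by rewrite /rconst tofrac_eq0 polyC_eq0. Qed.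

Lemma rconstM (a b : C) : rconst (a * b) = rconst a * rconst b.
Proof. by rewrite /rconst polyCM rmorphM. Qed.

Lemma rconst1 : rconst (1 : C) = 1.
Proof. by rewrite /rconst polyC1 rmorph1. Qed.

Lemma rconstN (a : C) : rconst (- a) = - rconst a.
Proof. by rewrite /rconst polyCN rmorphN. Qed.

Lemma rconst_i_sqr : rconst ('i%C : C) ^+ 2 = -1.
Proof. by rewrite expr2 -rconstM -expr2 sqr_i rconstN rconst1. Qed.

Lemma rconst_monomial_inj (a b : C) (n k : int) :
  a != 0 -> rconst a * s ^ n = rconst b * s ^ k -> n = k.
Proof.
move=> a0 eq_nk.
have b0 : b != 0.
  apply: contra_neq a0 => b0; apply/eqP; rewrite -rconst_eq0.
  move/eqP: eq_nk; rewrite b0 /rconst polyC0 rmorph0 mul0r mulf_eq0.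
  by rewrite (negPf (expfz_neq0 _ svar_neq0)) orbF.
(* Cancelling the lower power of [s] leaves [x X^d = y] between polynomials, and sizes force
   [d = 0]. *)
have main (x y : C) (i j : int) (d : nat) : x != 0 ->
    i = j + d%:Z -> rconst x * s ^ i = rconst y * s ^ j -> d = 0%N.
  move=> x0 ->; rewrite expfzDr ?svar_neq0 // mulrA mulrAC.
  move=> /(mulIf (expfz_neq0 _ svar_neq0)).
  rewrite /rconst /svar -exprnP -rmorphXn -rmorphM => /eqP; rewrite tofrac_eq.
  move=> /eqP/(congr1 (fun p : {poly C} => size p)).
  rewrite mul_polyC size_scale // size_polyXn size_polyC.
  by case: (y != 0) => //=; lia.
case: (lerP k n) => nk.
  have := main a b n k `|n - k|%N a0 _ eq_nk; lia.
have := main b a k n `|k - n|%N b0 _ (esym eq_nk); lia.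
Qed.

(** Parity of degrees: writing [f / s ^ j] as [p / q] gives [p^2 = c q^2 X], of even degree on the
    left and odd degree on the right. *)
Lemma odd_monomial_not_sqr (f : ratfun R) (c : C) (j : int) :
  c != 0 -> f ^+ 2 <> rconst c * s ^ (2 * j + 1).
Proof.
move=> c0 f2; have [p [q [q0 pE]]] := fracP (f / s ^ j).
have /eqP : tofrac (p ^+ 2) = tofrac (c *: (q ^+ 2 * 'X)).
  rewrite -mul_polyC tofracXn 2!tofracM tofracXn -pE exprMn expr_div_n f2.
  rewrite expfzDr ?svar_neq0 // mulrC [2 * j]mulrC -exprz_exp.
  have := expf_neq0 2 (expfz_neq0 j svar_neq0).
  rewrite -/(rconst c) -/svar expr1z => sj0.
  by rewrite [rconst c * _]mulrCA [X in _ * X]mulrAC mulfV // mul1r mulrCA.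
rewrite tofrac_eq => /eqP/(congr1 (fun p : {poly C} => size p)).
rewrite size_scale // size_mulX ?expf_neq0 //= => sizeE.
(* [size_exp] speaks of the predecessor of the size, which is the degree only when the size is
   nonzero. *)
have := size_exp p 2; have := size_exp q 2; have : size (q ^+ 2) != 0%N.
  by rewrite size_poly_eq0 expf_neq0.
rewrite sizeE; case: (size (q ^+ 2)) => // n _ /= -> /(congr1 odd).
by rewrite /= !muln2 !odd_double.
Qed.

(** * The exponent of the second root *)

Lemma laurent_exponent (f : ratfun R) (a b : C) (k : int) :
    a != 0 -> b != 0 -> is_laurent f ->
    f * (rconst a * s + rconst b * s ^ k)
      = rconst a * s * (rconst b * s ^ k) + 1 ->
  `|k - 1| <= 2.
Proof.
move=> a0 b0 [p [N fE]].
have {}fE : tofrac p = s ^+ N * f.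
  by rewrite fE mulrC divfK // expf_neq0 // svar_neq0.
have [d0|d0] := posnP `|k - 1|%N; first by lia.
move=> eqf; suff: (`|k - 1|%N <= 2)%N by lia.
set d := `|k - 1|%N in d0 *.
case: (lerP 1 k) => k1.
  have kE : s ^ k = s * s ^+ d.
    rewrite exprnP -[X in X * _]expr1z -expfzDr ?svar_neq0 //.
    by congr (_ ^ _); lia.
  rewrite kE in eqf; apply: (@laurent_gap_above_le2 C d N a b p) => //.
  apply/eqP; rewrite -tofrac_eq; apply/eqP.
  rewrite !(tofracM, tofracD, tofracXn, tofrac1) fE.
  by rewrite -/svar -/(rconst a) -/(rconst b) -[LHS]mulrA eqf.
(* Here [k < 1]: multiplying the identity by [s ^+ d] removes the negative powers of [s]. *)
have kE : s ^ k * s ^+ d = s.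
  rewrite exprnP -[RHS]expr1z -expfzDr ?svar_neq0 //.
  by congr (_ ^ _); lia.
apply: (@laurent_gap_below_le2 C d N a b p) => //.
apply/eqP; rewrite -tofrac_eq; apply/eqP.
rewrite !(tofracM, tofracD, tofracXn) fE -/svar -/(rconst a) -/(rconst b).
rewrite -mulrA -[in rconst b * s]kE !mulrA -!mulrDl.
by rewrite mulrA -[X in X * _ = _]mulrA eqf -mulrA mulrDl mul1r !mulrA.
Qed.

Lemma rational_specialization_exponent (F G : ratfun R) (k : int) :
  rational_specialization F G 1 k -> [\/ k = 1, k = -1 | k = 3].
Proof.
case=> F0 G0 lau _ [lam [mu [lam0 mu0]]]; rewrite expr1z => rootsFG.
have /homfly_char_rootsP[_ F2] := rootsFG.
have := laurent_exponent lam0 mu0 lau (homfly_unlink2_roots F0 G0 rootsFG).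
have F2E : F ^+ 2 = rconst (lam * mu) * s ^ (1 + k).
  by rewrite F2 rconstM expfzDr ?svar_neq0 // expr1z mulrACA.
have lm0 : lam * mu != 0 by rewrite mulf_neq0.
(* The bound leaves -1 to 3; the even values 0 and 2 would make [F ^ 2] a nonzero constant times [s]
   or [s ^ 3]. *)
have k0 : k <> 0.
    by move=> k0; apply: (@odd_monomial_not_sqr F _ 0 lm0); rewrite F2E k0.
have k2 : k <> 2.
    by move=> k2; apply: (@odd_monomial_not_sqr F _ 1 lm0); rewrite F2E k2.
move=> kle; have : k = 1 \/ k = -1 \/ k = 3 by lia.
by case=> [|[]] ?; [constructor 1|constructor 2|constructor 3].
Qed.

(** * Root pairs up to constants, and the three specializations in C(s) *)

(** Serves both to identify the roots of a given specialization and to tell the three listed pairs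
    apart. *)
Lemma same_pair_monomialP (a1 a2 b1 b2 : C) (n1 n2 k1 k2 : int) :
    a1 != 0 -> a2 != 0 -> b1 != 0 -> b2 != 0 ->
  same_pair_upto_const (rconst a1 * s ^ n1) (rconst a2 * s ^ n2)
                       (rconst b1 * s ^ k1) (rconst b2 * s ^ k2)
  <-> (n1 = k1 /\ n2 = k2) \/ (n1 = k2 /\ n2 = k1).
Proof.
move=> a10 a20 b10 b20; split.
  move=> [a [b [_ _]]]; rewrite !mulrA -!rconstM.
  by case=> -[/(rconst_monomial_inj a10) -> /(rconst_monomial_inj a20) ->];
    [left|right].
have divE (x y : C) (n : int) : y != 0 ->
    rconst x * s ^ n = rconst (x / y) * (rconst y * s ^ n).
  by move=> y0; rewrite mulrA -rconstM divfK.
case=> -[-> ->].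
  exists (a1 / b1), (a2 / b2); rewrite !mulf_neq0 ?invr_eq0 //; split=> //.
  by left; rewrite -!divE.
exists (a1 / b2), (a2 / b1); rewrite !mulf_neq0 ?invr_eq0 //; split=> //.
by right; rewrite -!divE.
Qed.

(** This and the next three put the listed roots into the monomial shape with integer exponent that
    the comparison lemmas expect. *)
Lemma svarE : s = rconst 1 * s ^ 1.
Proof. by rewrite rconst1 mul1r. Qed.

Lemma svarNE : - s = rconst (-1) * s ^ 1.
Proof. by rewrite rconstN rconst1 mulN1r. Qed.

Lemma svarVE : s^-1 = rconst 1 * s ^ (-1).
Proof. by rewrite rconst1 mul1r. Qed.

Lemma svarX3E : s ^+ 3 = rconst 1 * s ^ 3.
Proof. by rewrite rconst1 mul1r. Qed.

Lemma rconst_i_neq0 : rconst ('i%C : C) != 0.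
Proof. by rewrite rconst_eq0 eq_complex /= oner_eq0 andbF. Qed.

Lemma svar_neqV : s - s^-1 != 0.
Proof.
rewrite subr_eq0 svarVE [X in X != _]svarE; apply/eqP.
by move/(rconst_monomial_inj (oner_neq0 _)).
Qed.

Lemma rational_specialization_alexander_conway :
  rational_specialization (@alexander_conway_l R) alexander_conway_m 1 (-1).
Proof.
rewrite /alexander_conway_l /alexander_conway_m; split=> //.
- exact: rconst_i_neq0.
- apply: mulf_neq0; first exact: rconst_i_neq0.
  by rewrite -opprB oppr_eq0 svar_neqV.
- exists 0, 0%N.
  by rewrite homfly_unlink2_alexander_conway ?tofrac0 ?mul0r ?rconst_i_sqr.
exists (-1), 1; rewrite oppr_eq0 !oner_neq0 -svarNE -svarVE; split=> //.
exact: homfly_char_roots_alexander_conway rconst_i_sqr svar_neq0.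
Qed.

Lemma rational_specialization_jones :
  rational_specialization (@jones_l R) jones_m 1 3.
Proof.
rewrite /jones_l /jones_m; split=> //.
- exact: mulf_neq0 rconst_i_neq0 (expf_neq0 2 svar_neq0).
- exact: mulf_neq0 rconst_i_neq0 svar_neqV.
- exists (- ('X ^+ 2 + 1)), 1%N.
  rewrite (homfly_unlink2_jones rconst_i_sqr svar_neq0 svar_neqV).
  by rewrite tofracN tofracD tofracXn tofrac1.
exists (-1), 1; rewrite oppr_eq0 !oner_neq0 -svarNE -svarX3E; split=> //.
exact: homfly_char_roots_jones rconst_i_sqr svar_neq0.
Qed.

Lemma rconst2 : rconst (2 : C) = 2.
Proof. by rewrite /rconst !rmorph_nat. Qed.

Lemma two_neq0 : (2 : ratfun R) != 0.
Proof. by rewrite -rconst2 rconst_eq0 pnatr_eq0. Qed.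

Lemma rconst_half : rconst (2^-1 : C) = 2^-1.
Proof.
apply: (mulfI two_neq0); rewrite (mulfV two_neq0) -rconst2 -rconstM.
by rewrite mulfV ?rconst1 // pnatr_eq0.
Qed.

Lemma rational_specialization_double :
  rational_specialization s (-2) 1 1.
Proof.
split=> //.
- exact: svar_neq0.
- by rewrite oppr_eq0 two_neq0.
- exists ((2^-1)%:P * ('X ^+ 2 + 1)), 1%N.
  rewrite (homfly_unlink2_double two_neq0 svar_neq0).
  by rewrite -rconst_half tofracM tofracD tofracXn tofrac1.
exists 1, 1; rewrite !oner_neq0 -svarE; split=> //.
exact: homfly_char_roots_double.
Qed.

End RationalFunctions.

Theorem theorem2p4 (R : realType) :
  let s : ratfun R := svar in
  (* every normalized rational specialization is one of the three *)
  (forall F G r1 r2 : ratfun R,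
     normalized_specialization F G ->
     homfly_char_roots F G r1 r2 ->
     (nondegenerate_specialization F G /\
        (same_pair_upto_const r1 r2 (- s) s^-1 \/
         same_pair_upto_const r1 r2 (- s) (s ^+ 3))) \/
     (degenerate_specialization F G /\ same_pair_upto_const r1 r2 s s)) /\
  (* all three occur *)
  [/\ normalized_specialization (@alexander_conway_l R) alexander_conway_m,
      nondegenerate_specialization (@alexander_conway_l R) alexander_conway_m
    & homfly_char_roots alexander_conway_l alexander_conway_m (- s) s^-1] /\
  [/\ normalized_specialization (@jones_l R) jones_m,
      nondegenerate_specialization (@jones_l R) jones_m
    & homfly_char_roots jones_l jones_m (- s) (s ^+ 3)] /\
  (exists F G : ratfun R,
     [/\ normalized_specialization F G,
         degenerate_specialization F G
       & homfly_char_roots F G s s]) /\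
  (* and they are pairwise distinct up to constants *)
  [/\ ~ same_pair_upto_const (- s) s^-1 (- s) (s ^+ 3),
      ~ same_pair_upto_const (- s) s^-1 s s
    & ~ same_pair_upto_const (- s) (s ^+ 3) s s].
Proof.
move=> s; split; [|split; [|split; [|split]]].
- move=> F G r1 r2 [k FGk] roots_r.
  have [_ _ _ _ [lam [mu [lam0 mu0 roots_s]]]] := FGk.
  have N10 : -1 != 0 :> R[i] by rewrite oppr_eq0 oner_neq0.
  (* Only the exponents 1 and [k] matter; the order in which [r1] and [r2] are listed is absorbed
     here. *)
  have same_pair (n j : int) (b1 b2 : R[i]) : b1 != 0 -> b2 != 0 ->
      n = 1 -> j = k ->
      same_pair_upto_const r1 r2 (rconst b1 * s ^ n) (rconst b2 * s ^ j).
    move=> b10 b20 -> ->.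
    have [[-> ->]|[-> ->]] := homfly_char_roots_uniq roots_r roots_s.
      by apply/same_pair_monomialP => //; left.
    by apply/same_pair_monomialP => //; right.
  have [kE|kE|kE] := rational_specialization_exponent FGk.
  + right; split; first by exists 1; rewrite -{2}kE.
    by rewrite /s svarE; apply: same_pair => //; rewrite oner_neq0.
  + left; split; first by exists 1, k; rewrite {1}kE.
    left; rewrite /s svarNE svarVE.
    by apply: same_pair => //; rewrite oner_neq0.
  left; split; first by exists 1, k; rewrite {1}kE.
  right; rewrite /s svarNE svarX3E.
  by apply: same_pair => //; rewrite oner_neq0.
- have ac := rational_specialization_alexander_conway R.
  split; [by exists (-1) | by exists 1, (-1) | ].
  exact: homfly_char_roots_alexander_conway (rconst_i_sqr R) (svar_neq0 R).
- have jones := rational_specialization_jones R.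
  split; [by exists 3 | by exists 1, 3 | ].
  exact: homfly_char_roots_jones (rconst_i_sqr R) (svar_neq0 R).
- have double := rational_specialization_double R.
  exists s, (-2); split; [by exists 1 | by exists 1 | ].
  exact: homfly_char_roots_double.
have N10 : -1 != 0 :> R[i] by rewrite oppr_eq0 oner_neq0.
have not_same (a1 a2 b1 b2 : R[i]) (n1 n2 k1 k2 : int) :
    a1 != 0 -> a2 != 0 -> b1 != 0 -> b2 != 0 ->
    ~ ((n1 = k1 /\ n2 = k2) \/ (n1 = k2 /\ n2 = k1)) ->
    ~ same_pair_upto_const (rconst a1 * s ^ n1) (rconst a2 * s ^ n2)
                           (rconst b1 * s ^ k1) (rconst b2 * s ^ k2).
  by move=> a10 a20 b10 b20 n_k /same_pair_monomialP-/(_ a10 a20 b10 b20).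
split.
(* The exponent pairs {1, -1}, {1, 3} and {1, 1} are pairwise different. *)
- have := @not_same (-1) 1 (-1) 1 1 (-1) 1 3.
  by rewrite -svarNE -svarVE -svarX3E; apply; rewrite ?oner_neq0 //; lia.
- have := @not_same (-1) 1 1 1 1 (-1) 1 1.
  by rewrite -svarNE -svarVE -svarE; apply; rewrite ?oner_neq0 //; lia.
have := @not_same (-1) 1 1 1 1 3 1 1.
by rewrite -svarNE -svarX3E -svarE; apply; rewrite ?oner_neq0 //; lia.
Qed.
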